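(* Let $\mathcal{A}$ be an abelian category. Let $M=\bigoplus_{i\in I}M_i$ be a direct sum decomposition of an object $M$ of $\mathcal{A}$. (1) Then $M$ is strongly self-Baer if and only if $M_i$ is strongly self-Baer for every $i\in I$, ${\rm Hom}_{\mathcal{A}}(M_i,M_j)=0$ for every $i,j\in I$ with $i\neq j$, and $N=\bigoplus_{i\in I}(N\cap M_i)$ for every direct summand $N$ of $M$. (2) Then $M$ is dual strongly self-Baer if and only if $M_i$ is dual strongly self-Baer for every $i\in I$, ${\rm Hom}_{\mathcal{A}}(M_i,M_j)=0$ for every $i,j\in I$ with $i\neq j$, and $N=\bigoplus_{i\in I}(N\cap M_i)$ for every direct summand $N$ of $M$.
   Context: A direct summand $K$ of an object $X$ of an abelian category, with inclusion $k:K\to X$, is fully invariant if for every endomorphism $h:X\to X$ there is a morphism $\alpha:K\to K$ with $hk=k\alpha$ (i.e. $h(K)\subseteq K$). An object $X$ is strongly self-Baer if for every family $(f_j)_{j\in J}$ of endomorphisms of $X$, $\bigcap_{j\in J}{\rm Ker}(f_j)$ is a fully invariant direct summand of $X$; it is dual strongly self-Baer if for every such family, $\sum_{j\in J}{\rm Im}(f_j)$ is a fully invariant direct summand of $X$.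
   Formalization: In the ''if'' direction of (1) it is additionally assumed that the projections M → M_i are jointly monic (automatic for finite I or under AB5); without this the claim fails, e.g. in the opposite of modules over k^ℕ with M = k^ℕ. *)

(* Defs.v *)
From mathcomp Require Import all_boot all_algebra.

Set Implicit Arguments.
Unset Strict Implicit.
Unset Printing Implicit Defensive.

Import GRing.Theory.
Local Open Scope ring_scope.

Declare Scope cat_scope.
Delimit Scope cat_scope with cat.

(* Every set carries the choice structure required by [zmodType] (classically),
   so taking hom-groups in [zmodType] is no restriction. *)
Record preadditiveCat := PreadditiveCat {
  ob :> Type;
  hom : ob -> ob -> zmodType;
  idm : forall X, hom X X;
  comp : forall X Y Z, hom Y Z -> hom X Y -> hom X Z;
  comp1m : forall X Y (f : hom X Y), comp (idm Y) f = f;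
  compm1 : forall X Y (f : hom X Y), comp f (idm X) = f;
  compA : forall X Y Z T (h : hom Z T) (g : hom Y Z) (f : hom X Y),
    comp h (comp g f) = comp (comp h g) f;
  compDl : forall X Y Z (g g' : hom Y Z) (f : hom X Y),
    comp (g + g') f = comp g f + comp g' f;
  compDr : forall X Y Z (g : hom Y Z) (f f' : hom X Y),
    comp g (f + f') = comp g f + comp g f'
}.

Arguments hom {_} _ _.
Arguments idm {_} _.
Arguments comp {_ _ _ _} _ _.

Notation "g \co f" := (comp g f) (at level 40, left associativity) : cat_scope.
Local Open Scope cat_scope.

Definition mono (C : preadditiveCat) (X Y : C) (f : hom X Y) : Prop :=
  forall (Z : C) (x y : hom Z X), f \co x = f \co y -> x = y.

Definition epi (C : preadditiveCat) (X Y : C) (f : hom X Y) : Prop :=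
  forall (Z : C) (x y : hom Y Z), x \co f = y \co f -> x = y.

Definition is_zero_object (C : preadditiveCat) (Z : C) : Prop :=
  forall X : C, (forall f : hom X Z, f = 0) /\ (forall f : hom Z X, f = 0).

Definition is_biproduct (C : preadditiveCat) (X Y P : C)
    (i : hom X P) (j : hom Y P) (p : hom P X) (q : hom P Y) : Prop :=
  [/\ p \co i = idm X, q \co j = idm Y, p \co j = 0, q \co i = 0
    & i \co p + j \co q = idm P].

Definition is_kernel (C : preadditiveCat) (X Y K : C)
    (f : hom X Y) (k : hom K X) : Prop :=
  f \co k = 0 /\
  forall (Z : C) (x : hom Z X), f \co x = 0 ->
    exists! y : hom Z K, k \co y = x.

Definition is_cokernel (C : preadditiveCat) (X Y Q : C)
    (f : hom X Y) (c : hom Y Q) : Prop :=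
  c \co f = 0 /\
  forall (Z : C) (x : hom Y Z), x \co f = 0 ->
    exists! y : hom Q Z, y \co c = x.

Record abelianCat := AbelianCat {
  abelian_base :> preadditiveCat;
  has_zero_object : exists Z : abelian_base, is_zero_object Z;
  has_biproducts : forall X Y : abelian_base,
    exists (P : abelian_base) (i : hom X P) (j : hom Y P)
           (p : hom P X) (q : hom P Y), is_biproduct i j p q;
  has_kernels : forall (X Y : abelian_base) (f : hom X Y),
    exists (K : abelian_base) (k : hom K X), is_kernel f k;
  has_cokernels : forall (X Y : abelian_base) (f : hom X Y),
    exists (Q : abelian_base) (c : hom Y Q), is_cokernel f c;
  mono_is_kernel : forall (X Y : abelian_base) (f : hom X Y), mono f ->
    exists (Z : abelian_base) (g : hom Y Z), is_kernel g f;
  epi_is_cokernel : forall (X Y : abelian_base) (f : hom X Y), epi f ->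
    exists (Z : abelian_base) (g : hom Z X), is_cokernel g f
}.

Record subobject (C : preadditiveCat) (X : C) := Subobject {
  sub_ob :> ob C;
  incl : hom sub_ob X;
  incl_mono : mono incl
}.

Definition subob_le (C : preadditiveCat) (X : C) (S T : subobject X) : Prop :=
  exists a : hom S T, incl S = incl T \co a.

(* Equality of subobjects is mutual [subob_le]: intersections, sums, kernels
   and images are therefore relations, defined up to isomorphism over [X]. *)
Definition is_intersection (C : preadditiveCat) (X : C) (J : Type)
    (F : J -> subobject X) (S : subobject X) : Prop :=
  (forall j, subob_le S (F j)) /\
  forall T : subobject X, (forall j, subob_le T (F j)) -> subob_le T S.

Definition is_sum (C : preadditiveCat) (X : C) (J : Type)
    (F : J -> subobject X) (S : subobject X) : Prop :=
  (forall j, subob_le (F j) S) /\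
  forall T : subobject X, (forall j, subob_le (F j) T) -> subob_le S T.

Definition is_Ker (C : preadditiveCat) (X Y : C) (f : hom X Y)
    (K : subobject X) : Prop :=
  is_kernel f (incl K).

Definition is_Im (C : preadditiveCat) (X Y : C) (f : hom X Y)
    (S : subobject Y) : Prop :=
  exists (Q : C) (c : hom Y Q), is_cokernel f c /\ is_kernel c (incl S).

Definition direct_summand (C : preadditiveCat) (X : C)
    (K : subobject X) : Prop :=
  exists (L : C) (l : hom L X) (p : hom X K) (q : hom X L),
    is_biproduct (incl K) l p q.

Definition fully_invariant (C : preadditiveCat) (X : C)
    (K : subobject X) : Prop :=
  forall h : hom X X, exists a : hom K K, h \co incl K = incl K \co a.

(* Infinite intersections and sums of subobjects need not exist in an abelian
   category; their existence is part of the two properties below. *)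
Definition strongly_self_Baer (C : preadditiveCat) (X : C) : Prop :=
  forall (J : Type) (f : J -> hom X X) (Ker : J -> subobject X),
    (forall j, is_Ker (f j) (Ker j)) ->
    exists K : subobject X,
      [/\ is_intersection Ker K, direct_summand K & fully_invariant K].

Definition dual_strongly_self_Baer (C : preadditiveCat) (X : C) : Prop :=
  forall (J : Type) (f : J -> hom X X) (Im : J -> subobject X),
    (forall j, is_Im (f j) (Im j)) ->
    exists S : subobject X,
      [/\ is_sum Im S, direct_summand S & fully_invariant S].

Definition is_coproduct (C : preadditiveCat) (I : Type) (F : I -> C) (X : C)
    (u : forall i, hom (F i) X) : Prop :=
  forall (Y : C) (f : forall i, hom (F i) Y),
    exists! g : hom X Y, forall i, g \co u i = f i.

Definition is_direct_sum_decomposition (C : preadditiveCat) (X : C) (I : Type)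
    (D : I -> subobject X) : Prop :=
  is_coproduct (fun i => incl (D i)).

Definition is_direct_sum_of (C : preadditiveCat) (X : C) (I : Type)
    (N : subobject X) (D : I -> subobject X) : Prop :=
  exists v : forall i, hom (D i) N,
    (forall i, incl N \co v i = incl (D i)) /\ is_coproduct v.

(* N = \bigoplus_i (N \cap M_i) for every direct summand N *)
Definition summands_decompose (C : preadditiveCat) (M : C) (I : Type)
    (M_ : I -> subobject M) : Prop :=
  forall N : subobject M, direct_summand N ->
  forall D : I -> subobject M,
    (forall i, is_intersection (fun b : bool => if b then N else M_ i) (D i)) ->
    is_direct_sum_of N D.

Definition pairwise_hom_zero (C : preadditiveCat) (M : C) (I : Type)
    (M_ : I -> subobject M) : Prop :=
  forall i j : I, i <> j -> forall g : hom (M_ i) (M_ j), g = 0.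

Definition is_projection (C : preadditiveCat) (M : C) (I : Type)
    (M_ : I -> subobject M) (i : I) (p : hom M (M_ i)) : Prop :=
  p \co incl (M_ i) = idm (M_ i) /\
  forall j : I, j <> i -> p \co incl (M_ j) = 0.

(* Says that the canonical morphism from the direct sum of the M_i to their
   product (when the latter exists) is a monomorphism. This is automatic if I
   is finite or the category satisfies AB5, but not in general. It fails in the
   opposite of the category of modules over R = k^nat (k a field), with M = R
   and M_i the i-th factor of R; there each M_i is strongly self-Baer, the M_i
   are Hom-orthogonal and every direct summand of M decomposes along them, but
   M is not strongly self-Baer. *)
Definition projections_jointly_monic (C : preadditiveCat) (M : C) (I : Type)
    (M_ : I -> subobject M) : Prop :=
  forall (Z : C) (x y : hom Z M),
    (forall (i : I) (p : hom M (M_ i)), is_projection p -> p \co x = p \co y) ->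
    x = y.

(* Main.v *)
From mathcomp Require Import all_boot all_algebra.
From Stdlib Require Import Classical ClassicalEpsilon.
Require Import Defs.

(** Both properties make every direct summand of M fully invariant, and if all
    the M_i are fully invariant, then the idempotent of a summand N maps each
    M_i into the intersection of N and M_i, so that N is the direct sum of
    these intersections.
    Conversely, suppose that the M_i are Hom-orthogonal and that summands
    decompose. If phi : M_i -> M is killed by all the projections, then the
    graph of phi, i.e. the image of u_i + phi (u_i the inclusion of M_i), is a
    summand of M which meets M_k trivially for k <> i and meets M_i in the
    kernel of phi; as it decomposes, phi = 0. Hence every endomorphism of M is
    diagonal, and the summands of the M_i obtained from their own (dual) Baer
    property add up to a fully invariant summand of M. It is the sum of the
    given images; that it contains the whole intersection of the given kernels
    is checked on components, which needs the projections to be jointly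
    monic. *)

Set Implicit Arguments.
Unset Strict Implicit.
Unset Printing Implicit Defensive.

Import GRing.Theory.
Local Open Scope ring_scope.
Local Open Scope cat_scope.

Lemma choose_family (I : Type) (T : I -> Type) (P : forall i, T i -> Prop) :
  (forall i, exists x, P i x) -> exists F : forall i, T i, forall i, P i (F i).
Proof.
move=> ex_P; exists (fun i => proj1_sig (constructive_indefinite_description _ (ex_P i))).
by move=> i; case: constructive_indefinite_description.
Qed.

(** * Monomorphisms, kernels and subobjects in a preadditive category *)

Section Preadditive.
Variable C : preadditiveCat.
Implicit Types X Y Z : C.

Lemma compm0 X Y Z (g : hom Y Z) : g \co (0 : hom X Y) = 0.
Proof. by apply: (addrI (g \co 0)); rewrite -compDr !addr0. Qed.

Lemma comp0m X Y Z (f : hom X Y) : (0 : hom Y Z) \co f = 0.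
Proof. by apply: (addrI (0 \co f)); rewrite -compDl !addr0. Qed.

Lemma compNl X Y Z (g : hom Y Z) (f : hom X Y) : (- g) \co f = - (g \co f).
Proof. by apply: (addrI (g \co f)); rewrite -compDl !subrr comp0m. Qed.

Lemma compNr X Y Z (g : hom Y Z) (f : hom X Y) : g \co (- f) = - (g \co f).
Proof. by apply: (addrI (g \co f)); rewrite -compDr !subrr compm0. Qed.

Lemma compBl X Y Z (g h : hom Y Z) (f : hom X Y) :
  (g - h) \co f = g \co f - h \co f.
Proof. by rewrite compDl compNl. Qed.

Lemma compBr X Y Z (g : hom Y Z) (f h : hom X Y) :
  g \co (f - h) = g \co f - g \co h.
Proof. by rewrite compDr compNr. Qed.

Lemma mono_comp X Y Z (g : hom Y Z) (f : hom X Y) :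
  mono g -> mono f -> mono (g \co f).
Proof. by move=> mono_g mono_f W x y; rewrite -!compA => /mono_g/mono_f. Qed.

Lemma mono_compl X Y Z (g : hom Y Z) (f : hom X Y) : mono (g \co f) -> mono f.
Proof. by move=> mono_gf W x y Exy; apply: mono_gf; rewrite -!compA Exy. Qed.

Lemma split_mono X Y (r : hom Y X) (s : hom X Y) : r \co s = idm X -> mono s.
Proof.
by move=> rs W x y Exy; rewrite -(comp1m x) -(comp1m y) -rs -!compA Exy.
Qed.

Lemma kernel_mono X Y K (f : hom X Y) (k : hom K X) : is_kernel f k -> mono k.
Proof.
move=> [fk0 k_univ] Z x y Exy.
have [|z [_ z_uniq]] := k_univ Z (k \co y); first by rewrite compA fk0 comp0m.
by rewrite -(z_uniq x) // -(z_uniq y).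
Qed.

Lemma kernel_factor X Y K Z (f : hom X Y) (k : hom K X) (x : hom Z X) :
  is_kernel f k -> f \co x = 0 -> exists y, x = k \co y.
Proof. by move=> [_ k_univ] /k_univ [y [<- _]]; exists y. Qed.

(** [subob_le S T] and the instances of [fully_invariant] unfold to this, so the lemmas on it serve
    all three notions. *)
Definition factors X Z (x : hom Z X) (T : subobject X) : Prop :=
  exists y, x = incl T \co y.

Lemma factors_comp X Y Z (x : hom Y X) (y : hom Z Y) (T : subobject X) :
  factors x T -> factors (x \co y) T.
Proof. by move=> [z ->]; exists (z \co y); rewrite compA. Qed.

Lemma factors_le X Z (x : hom Z X) (S T : subobject X) :
  factors x S -> subob_le S T -> factors x T.
Proof. by move=> [z ->] ST; apply: factors_comp. Qed.

Lemma subob_le_refl X (S : subobject X) : subob_le S S.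
Proof. by exists (idm S); rewrite compm1. Qed.

Lemma fully_invariant_eq X (S T : subobject X) :
  subob_le S T -> subob_le T S -> fully_invariant S -> fully_invariant T.
Proof.
move=> ST [a Ta] fiS h; apply: factors_le ST.
by rewrite Ta compA; apply: factors_comp.
Qed.

Lemma le_KerP X Y (f : hom X Y) (K T : subobject X) :
  is_Ker f K -> subob_le T K <-> f \co incl T = 0.
Proof.
move=> kerK; split; last exact: kernel_factor.
by move=> [a ->]; rewrite compA (proj1 kerK) comp0m.
Qed.

Lemma is_intersection_inP X (S T D : subobject X) :
  is_intersection (fun b : bool => if b then S else T) D <->
  [/\ subob_le D S, subob_le D T
    & forall E, subob_le E S -> subob_le E T -> subob_le E D].
Proof.
split=> [[lb glb]|[DS DT glb]].
  by split=> [||E ES ET]; [apply: (lb true)|apply: (lb false)|apply: glb; case].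
by split=> [[]//|E lb]; apply: glb; [apply: (lb true)|apply: (lb false)].
Qed.

(** * Coproducts and the projections of a direct sum *)

Section Coproduct.
Variables (I : Type) (F : I -> C) (X : C) (u : forall i, hom (F i) X).
Hypothesis coprod_u : is_coproduct u.

Lemma coproduct_desc Y (f : forall i, hom (F i) Y) :
  exists g : hom X Y, forall i, g \co u i = f i.
Proof. by have [g [Eg _]] := coprod_u f; exists g. Qed.

Lemma coproduct_eq Y (g h : hom X Y) :
  (forall i, g \co u i = h \co u i) -> g = h.
Proof.
move=> Egh; have [k [_ k_uniq]] := coprod_u (fun i => h \co u i).
by rewrite -(k_uniq g) // -(k_uniq h).
Qed.

End Coproduct.

Section Projections.
Variables (M : C) (I : Type) (M_ : I -> subobject M).
Hypothesis dec_M : is_direct_sum_decomposition M_.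

Lemma projection_exists i : exists p : hom M (M_ i), is_projection p.
Proof.
(* A Kronecker delta specified by equations, since the type of [f] varies with [k]; composing with
   [incl (M_ i)] avoids a transport along [k = i]. *)
have /choose_family[f Hf] k : exists f : hom (M_ k) (M_ i),
    (k <> i -> f = 0) /\ (k = i -> incl (M_ i) \co f = incl (M_ k)).
  have [Eki|ne_ki] := classic (k = i).
    by subst k; exists (idm _); split=> // _; rewrite compm1.
  by exists 0; split.
have [p Ep] := coproduct_desc dec_M f; exists p; split=> [|j ne_ji].
  by apply: (@incl_mono _ _ (M_ i)); rewrite compm1 Ep; apply: (proj2 (Hf i)).
by rewrite Ep; apply: (proj1 (Hf j)).
Qed.

Lemma projections_exist :
  exists p : forall i, hom M (M_ i), forall i, is_projection (p i).
Proof. exact: choose_family projection_exists. Qed.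

End Projections.

End Preadditive.

(** * Images, idempotents and intersections in an abelian category *)

Section Abelian.
Variable A : abelianCat.
Implicit Types X Y Z : A.

Lemma Ker_exists X Y (f : hom X Y) : exists K : subobject X, is_Ker f K.
Proof.
have [K [k kerk]] := has_kernels f.
by exists (Subobject (kernel_mono kerk)).
Qed.

Lemma subobject_is_Ker X (K : subobject X) :
  exists (Z : A) (g : hom X Z), is_Ker g K.
Proof. exact: mono_is_kernel (@incl_mono _ _ K). Qed.

Lemma Im_exists X Y (f : hom X Y) : exists S : subobject Y, is_Im f S.
Proof.
have [Q [c cokc]] := has_cokernels f; have [S kerS] := Ker_exists c.
by exists S, Q, c.
Qed.

Lemma cokernel_factor X Y Q Z (f : hom X Y) (c : hom Y Q) (x : hom Y Z) :
  is_cokernel f c -> x \co f = 0 -> exists y, x = y \co c.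
Proof. by move=> [_ c_univ] /c_univ [y [<- _]]; exists y. Qed.

(** [T] is the kernel of some [g]; if [f] factors through [T], then [g] kills [f], so [g] factors
    through the cokernel of [f] and kills the image. *)
Lemma Im_leP X Y (f : hom X Y) (S T : subobject Y) :
  is_Im f S -> subob_le S T <-> factors f T.
Proof.
move=> [Q [c [cokc kerS]]]; split=> [|[y Ey]].
  by apply: factors_le; apply: kernel_factor kerS _; case: cokc.
have [Z [g kerT]] := subobject_is_Ker T.
have [|g' Eg] := cokernel_factor (x := g) cokc.
  by rewrite Ey compA (proj1 kerT) comp0m.
by apply: kernel_factor kerT _; rewrite Eg -compA (proj1 kerS) compm0.
Qed.

(** If [x] and [y] agree after [e], then [e] lands in the kernel of [x - y]; minimality of the image
    makes that kernel all of [S]. *)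
Lemma Im_corestriction_epi X Y (f : hom X Y) (S : subobject Y) (e : hom X S) :
  is_Im f S -> f = incl S \co e -> epi e.
Proof.
move=> ImS Ef Z x y Exy; have [K kerK] := Ker_exists (x - y).
have [|e' Ee] := kernel_factor (x := e) kerK; first by rewrite compBl Exy subrr.
pose T := Subobject (mono_comp (@incl_mono _ _ S) (@incl_mono _ _ K)).
have [|a Ea] := proj2 (Im_leP T ImS).
  by exists e'; rewrite Ef Ee compA.
have Ka1 : incl K \co a = idm S.
  by apply: (@incl_mono _ _ S); rewrite compA compm1.
apply/eqP; rewrite -subr_eq0 -[x - y]compm1 -Ka1 compA.
by case: kerK => -> _; rewrite comp0m.
Qed.

Lemma idempotent_split X (e : hom X X) : e \co e = e ->
  exists (S : subobject X) (r : hom X S),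
    r \co incl S = idm S /\ incl S \co r = e.
Proof.
move=> ee; have [S kerS] := Ker_exists (idm X - e).
have [|r Er] := kernel_factor (x := e) kerS; first by rewrite compBl comp1m ee subrr.
exists S, r; split=> //; apply: (@incl_mono _ _ S).
rewrite compA -Er compm1; apply/eqP; rewrite eq_sym -subr_eq0.
by rewrite -{1}[incl S]comp1m -compBl; case: kerS => ->.
Qed.

(** Given a retraction [r], the complement comes from splitting the idempotent [1 - k r]. *)
Lemma direct_summandP X (K : subobject X) :
  direct_summand K <-> exists r : hom X K, r \co incl K = idm K.
Proof.
split=> [[L [l [p [q [pk _ _ _ _]]]]]|[r rk]]; first by exists p.
pose e := incl K \co r.
have ee : (idm X - e) \co (idm X - e) = idm X - e.
  rewrite compBl comp1m compBr compm1 /e -compA.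
  by rewrite (compA r) rk comp1m subrr subr0.
have [L [q [qL Lq]]] := idempotent_split ee.
exists L, (incl L), r, q; split=> //; last by rewrite Lq addrC subrK.
- have: r \co (idm X - e) = 0 by rewrite compBr compm1 /e compA rk comp1m subrr.
  rewrite -Lq => rLq; rewrite -[incl L]compm1 -qL !compA.
  by rewrite -(compA r) rLq comp0m.
- apply: (@incl_mono _ _ L); rewrite compA Lq compm0 compBl comp1m /e -compA rk.
  by rewrite compm1 subrr.
Qed.

Lemma intersection_exists X (S T : subobject X) :
  exists D, is_intersection (fun b : bool => if b then S else T) D.
Proof.
have [Z [g kerS]] := subobject_is_Ker S.
have [K kerK] := Ker_exists (g \co incl T).
exists (Subobject (mono_comp (@incl_mono _ _ T) (@incl_mono _ _ K))).
apply/is_intersection_inP; split=> [||E ES [b Eb]].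
- by apply/(le_KerP _ kerS); rewrite /= compA; case: kerK.
- by exists (incl K).
- have [|a Ea] := kernel_factor (x := b) kerK.
    by rewrite -compA -Eb; apply/(le_KerP _ kerS).
  by exists a; rewrite Eb Ea compA.
Qed.

(** The universal property of an intersection concerns subobjects only; passing to the image of [x]
    extends it to arbitrary morphisms. *)
Lemma factors_intersection X Z (x : hom Z X) (S T D : subobject X) :
  is_intersection (fun b : bool => if b then S else T) D ->
  factors x S -> factors x T -> factors x D.
Proof.
move=> /is_intersection_inP[_ _ glb] xS xT.
have [E ImE] := Im_exists x.
have xE : factors x E by apply/(Im_leP _ ImE); apply: subob_le_refl.
by apply: factors_le xE _; apply: glb; apply/(Im_leP _ ImE).
Qed.

(** * The two Baer properties and their inheritance by direct summands *)

Lemma strongly_self_BaerP X :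
  strongly_self_Baer X <->
  forall (J : Type) (f : J -> hom X X), exists K : subobject X,
    [/\ forall T, subob_le T K <-> forall j, f j \co incl T = 0,
        direct_summand K & fully_invariant K].
Proof.
split=> Baer J f => [|Ker kerf].
  have [Ker kerf] := choose_family (fun j => Ker_exists (f j)).
  have [K [[lb glb] dsK fiK]] := Baer J f Ker kerf.
  exists K; split=> // T; split=> [TK j|fT0].
    by apply/(le_KerP _ (kerf j)); apply: factors_le TK (lb j).
  by apply: glb => j; apply/(le_KerP _ (kerf j)).
have [K [leK dsK fiK]] := Baer J f; exists K; split=> //; split=> [j|T TKer].
  by apply/(le_KerP _ (kerf j)); move: j; apply/leK; apply: subob_le_refl.
by apply/leK => j; apply/(le_KerP _ (kerf j)).
Qed.

(** Images exist, as kernels do above, so the family [Im] can be eliminated: containing every image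
    means that every [f j] factors through. *)
Lemma dual_strongly_self_BaerP X :
  dual_strongly_self_Baer X <->
  forall (J : Type) (f : J -> hom X X), exists S : subobject X,
    [/\ forall T, subob_le S T <-> forall j, factors (f j) T,
        direct_summand S & fully_invariant S].
Proof.
split=> Baer J f => [|Im Imf].
  have [Im Imf] := choose_family (fun j => Im_exists (f j)).
  have [S [[ub lub] dsS fiS]] := Baer J f Im Imf.
  exists S; split=> // T; split=> [ST j|fT].
    by apply/(Im_leP _ (Imf j)); apply: factors_le ST; apply: ub.
  by apply: lub => j; apply/(Im_leP _ (Imf j)).
have [S [leS dsS fiS]] := Baer J f; exists S; split=> //; split=> [j|T ImT].
  by apply/(Im_leP _ (Imf j)); move: j; apply/leS; apply: subob_le_refl.
by apply/leS => j; apply/(Im_leP _ (Imf j)).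
Qed.

(** [K] is the kernel of [1 - k r], hence the intersection of a one-member family of kernels. *)
Lemma Baer_summand_invariant X (K : subobject X) :
  strongly_self_Baer X -> direct_summand K -> fully_invariant K.
Proof.
move=> /strongly_self_BaerP Baer /direct_summandP[r rk].
have [S [leS _ fiS]] := Baer unit (fun=> idm X - incl K \co r).
apply: fully_invariant_eq fiS.
  exists (r \co incl S); apply/eqP; rewrite -subr_eq0 compA -{1}[incl S]comp1m.
  by rewrite -compBl; apply/eqP/(proj1 (leS S) (subob_le_refl S) tt).
by apply/leS => _; rewrite compBl comp1m -compA rk compm1 subrr.
Qed.

(** Here [K] is the image of the idempotent [k r]. *)
Lemma dual_Baer_summand_invariant X (K : subobject X) :
  dual_strongly_self_Baer X -> direct_summand K -> fully_invariant K.
Proof.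
move=> /dual_strongly_self_BaerP Baer /direct_summandP[r rk].
have [S [leS _ fiS]] := Baer unit (fun=> incl K \co r).
apply: fully_invariant_eq fiS; first by apply/leS => _; exists r.
rewrite /subob_le -[incl K]compm1 -rk compA; apply: factors_comp.
exact: (proj1 (leS S) (subob_le_refl S) tt).
Qed.

(** [T] is [S] seen inside [K]. An endomorphism [h] of [K] extends to [k h r] on [X], so invariance
    in [X] gives invariance in [K]. *)
Lemma restrict_summand X (K S : subobject X) (a : hom S K) :
  direct_summand K -> incl S = incl K \co a ->
  direct_summand S -> fully_invariant S ->
  exists2 T : subobject K, direct_summand T /\ fully_invariant T
    & forall Z (x : hom Z K), factors x T <-> factors (incl K \co x) S.
Proof.
move=> /direct_summandP[r rk] ES /direct_summandP[p pS] fiS.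
have mono_a : mono a.
  by apply: (@mono_compl _ _ _ _ (incl K)); rewrite -ES; apply: incl_mono.
exists (Subobject mono_a) => [|Z x]; first split.
- by apply/direct_summandP; exists (p \co incl K); rewrite /= -compA -ES.
- move=> h; have [b Eb] := fiS (incl K \co h \co r); exists b => /=.
  apply: (@incl_mono _ _ K); rewrite !compA -ES -Eb ES.
  by rewrite compA -(compA _ r) rk compm1.
- split=> [[y ->]|[y Ey]]; exists y; first by rewrite /= compA ES.
  by apply: (@incl_mono _ _ K); rewrite Ey ES compA.
Qed.

Lemma Baer_summand X (K : subobject X) :
  direct_summand K -> strongly_self_Baer X -> strongly_self_Baer (K : A).
Proof.
move=> dsK /strongly_self_BaerP Baer; apply/strongly_self_BaerP => J f.
have /direct_summandP[r rk] := dsK.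
(* The extra endomorphism [1 - k r], whose kernel is [K], confines the
   intersection to [K]. *)
pose g o := if o is Some j then incl K \co f j \co r else idm X - incl K \co r.
have [S [leS dsS fiS]] := Baer (option J) g.
have gS := proj1 (leS S) (subob_le_refl S).
have ES : incl S = incl K \co (r \co incl S).
  by apply/eqP; rewrite -subr_eq0 compA -{1}[incl S]comp1m -compBl (gS None).
have [T [dsT fiT] facT] := restrict_summand dsK ES dsS fiS.
exists T; split=> // U.
pose KU := Subobject (mono_comp (@incl_mono _ _ K) (@incl_mono _ _ U)).
split=> [UT j|fU0]; last first.
  apply/facT; apply/(leS KU) => -[j|] /=.
    by rewrite -(compA _ r) (compA r) rk comp1m -compA fU0 compm0.
  by rewrite compBl comp1m compA -(compA _ r) rk compm1 subrr.
have /(leS KU)/(_ (Some j)) : subob_le KU S by apply/facT.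
rewrite /= -(compA _ r) (compA r) rk comp1m -compA => H.
by apply: (@incl_mono _ _ K); rewrite H compm0.
Qed.

Lemma dual_Baer_summand X (K : subobject X) :
  direct_summand K ->
  dual_strongly_self_Baer X -> dual_strongly_self_Baer (K : A).
Proof.
move=> dsK /dual_strongly_self_BaerP Baer; apply/dual_strongly_self_BaerP => J f.
have /direct_summandP[r rk] := dsK.
have [S [leS dsS fiS]] := Baer J (fun j => incl K \co f j \co r).
(* All the endomorphisms [k f_j r] factor through [K], so their sum of images [S] lies in [K]. *)
have [|a ES] := proj2 (leS K).
  by move=> j; exists (f j \co r); rewrite compA.
have [T [dsT fiT] facT] := restrict_summand dsK ES dsS fiS.
exists T; split=> // U; split=> [TU j|fU].
  apply: factors_le TU; apply/facT.
  rewrite -[incl K \co f j]compm1 -rk compA; apply: factors_comp.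
  exact: (proj1 (leS S) (subob_le_refl S)).
pose KU := Subobject (mono_comp (@incl_mono _ _ K) (@incl_mono _ _ U)).
have [|b Eb] := proj2 (leS KU).
  by move=> j; have [y ->] := fU j; exists (y \co r); rewrite /= !compA.
have [c Ec] := proj1 (facT T (incl T)) (subob_le_refl T).
exists (b \co c); apply: (@incl_mono _ _ K).
by rewrite Ec Eb !compA.
Qed.

(** * Summands and endomorphisms of a direct sum *)

Section DirectSum.
Variables (M : A) (I : Type) (M_ : I -> subobject M).
Hypothesis dec_M : is_direct_sum_decomposition M_.

Lemma component_direct_summand i : direct_summand (M_ i).
Proof.
have [p [pi _]] := projection_exists dec_M i.
by apply/direct_summandP; exists p.
Qed.

(** Precomposed with [p], [g] becomes an endomorphism of [M]; invariance puts the image of [g]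
    inside [M_ i], where the projection [q] to [M_ j] vanishes. *)
Lemma invariant_hom_zero :
  (forall i, fully_invariant (M_ i)) -> pairwise_hom_zero M_.
Proof.
move=> fiM i j ne_ij g.
have [p [pi _]] := projection_exists dec_M i.
have [q [qj qk]] := projection_exists dec_M j.
have [a Ea] := fiM i (incl (M_ j) \co g \co p).
move: Ea; rewrite -(compA _ p) pi compm1 => Ea.
by rewrite -(comp1m g) -qj -compA Ea compA qk // comp0m.
Qed.

Lemma invariant_summands_decompose :
  (forall i, fully_invariant (M_ i)) -> summands_decompose M_.
Proof.
move=> fiM N /direct_summandP[r rN] D interD.
have leDN i : subob_le (D i) N by have /is_intersection_inP[] := interD i.
have leDM i : subob_le (D i) (M_ i) by have /is_intersection_inP[] := interD i.
have [v Ev] := choose_family leDN.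
have [w Ew] := choose_family leDM.
have /choose_family[d Ed] i : exists d : hom (M_ i) (D i),
    incl N \co r \co incl (M_ i) = incl (D i) \co d.
  apply: factors_intersection (interD i) _ (fiM i _).
  by rewrite -compA; exists (r \co incl (M_ i)).
have rM i : r \co incl (M_ i) = v i \co d i.
  by apply: (@incl_mono _ _ N); rewrite !compA Ed Ev.
(* [D i] lies in [N], on which the idempotent [incl N \co r] is the identity. *)
have dw i : d i \co w i = idm (D i).
  apply: (@incl_mono _ _ (D i)); rewrite compm1 compA -Ed -compA -Ew.
  by rewrite [in LHS]Ev -compA (compA r) rN comp1m -Ev.
exists v; split=> // Y f.
have [g Eg] := coproduct_desc dec_M (fun i => f i \co d i).
exists (g \co incl N); split=> [i|h Eh].
  by rewrite -compA -Ev Ew compA Eg -compA dw compm1.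
(* Composing with [r] moves uniqueness to [M], where it can be checked on the components. *)
suff -> : g = h \co r by rewrite -compA rN compm1.
by apply: (coproduct_eq dec_M) => i; rewrite -compA rM compA Eh Eg.
Qed.

Lemma orthogonal_components_invariant :
  pairwise_hom_zero M_ -> summands_decompose M_ ->
  forall i, fully_invariant (M_ i).
Proof.
move=> hom0 decomp i h; have [p Hp] := projections_exist dec_M.
set u := incl (M_ i).
(* The only candidate for the induced endomorphism; its error [phi] has to vanish. *)
exists (p i \co h \co u); apply/eqP; rewrite -subr_eq0; apply/eqP.
set phi := _ - _.
have piu : p i \co u = idm _ := proj1 (Hp i).
have pphi : p i \co phi = 0 by rewrite compBr !compA piu comp1m subrr.
have retr : p i \co (u + phi) = idm _ by rewrite compDr piu pphi addr0.
(* The graph of [phi]. Its underlying object is that of [M_ i], so [phi] is a morphism out of [N]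
   and can be tested on the intersections [D k]. *)
pose N := Subobject (split_mono retr).
have dsN : direct_summand N by apply/direct_summandP; exists (p i).
have [D interD] := choose_family (fun k => intersection_exists N (M_ k)).
have [v [Ev coprod_v]] := decomp N dsN D interD.
apply: (coproduct_eq coprod_v) => k; rewrite comp0m.
have /is_intersection_inP[_ [w Ew] _] := interD k.
have := Ev k; rewrite Ew /= => Ek.
have vE : v k = p i \co incl (M_ k) \co w by rewrite -compA -Ek compA retr comp1m.
have [Eki|ne_ki] := classic (k = i); last first.
  by rewrite vE (proj2 (Hp i)) // comp0m compm0.
subst k; rewrite piu comp1m in vE.
(* The inclusions of [N] and [M_ i] agree on [D i]: [(u + phi) w = u w]. *)
by move: Ek; rewrite vE compDl => /(canRL (addKr _)) ->; rewrite addNr.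
Qed.

(** [T] stands for the direct sum of the [S i]; it is built as the image of a diagonal idempotent of
    [M], because infinite coproducts are not given in advance. *)
Lemma gather_summands (S : forall i, subobject (M_ i : A)) :
  (forall i, fully_invariant (M_ i)) ->
  (forall i, direct_summand (S i)) -> (forall i, fully_invariant (S i)) ->
  exists (T : subobject M) (r : hom M T) (s : forall i, hom (M_ i) (S i)),
    [/\ r \co incl T = idm T, fully_invariant T,
        forall i, s i \co incl (S i) = idm (S i)
      & forall i, incl T \co r \co incl (M_ i) =
                  incl (M_ i) \co (incl (S i) \co s i)].
Proof.
move=> fiM dsS fiS.
have [s sS] := choose_family (fun i => proj1 (direct_summandP (S i)) (dsS i)).
have [e Ee] := coproduct_desc dec_M (fun i => incl (M_ i) \co (incl (S i) \co s i)).
have eS i : e \co incl (M_ i) \co incl (S i) = incl (M_ i) \co incl (S i).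
  by rewrite Ee -!compA sS compm1.
have ee : e \co e = e.
  by apply: (coproduct_eq dec_M) => i; rewrite -compA Ee !compA eS.
have [T [r [rT Tr]]] := idempotent_split ee.
exists T, r, s; split=> // [h|i]; last by rewrite Tr Ee.
(* This equation says that [h] preserves the image of [e]. *)
suff ehe : e \co (h \co e) = h \co e.
  exists (r \co h \co incl T).
  rewrite !compA Tr -[in LHS](compm1 (incl T)) -rT !compA -(compA h) Tr.
  by rewrite -[in LHS]ehe -Tr -!compA rT compm1.
apply: (coproduct_eq dec_M) => i; have [a Ea] := fiM i h.
have [b Eb] := fiS i a.
by rewrite -!compA Ee !(compA h) Ea -!compA !(compA a) Eb !compA eS.
Qed.

Lemma Baer_direct_sum :
  (forall i, fully_invariant (M_ i)) -> projections_jointly_monic M_ ->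
  (forall i, strongly_self_Baer (M_ i : A)) -> strongly_self_Baer M.
Proof.
move=> fiM joint Baer; apply/strongly_self_BaerP => J f.
(* [g i j] is the restriction of [f j] to [M_ i], and [S i] will be the intersection of the kernels
   of the [g i j] over [j]. *)
have [g Eg] := choose_family (fun i => choose_family (fun j => fiM i (f j))).
have [S HS] := choose_family
  (fun i => proj1 (strongly_self_BaerP (M_ i)) (Baer i) J (g i)).
have [T [r [s [rT fiT sS Ts]]]] := @gather_summands S fiM
  (fun i => let: And3 _ ds _ := HS i in ds)
  (fun i => let: And3 _ _ fi := HS i in fi).
exists T; split=> //; last by apply/direct_summandP; exists r.
have gS i j : g i j \co incl (S i) = 0.
  by have [leS _ _] := HS i; apply: (proj1 (leS _) (subob_le_refl _)).
have fT j : f j \co (incl T \co r) = 0.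
  apply: (coproduct_eq dec_M) => i.
  by rewrite -compA Ts compA Eg comp0m -!compA (compA (g i j)) gS comp0m compm0.
move=> U; split=> [[a ->] j|fU0].
  by rewrite -[incl T]compm1 -rT !compA -(compA (f j)) fT !comp0m.
(* [U] lies in [T] once the idempotent of [T] fixes [incl U]; this equality of morphisms into [M] is
   tested by projections, which intertwine diagonal endomorphisms with their components. *)
exists (r \co incl U); rewrite compA; apply: joint => i p [pi pk].
have [leS _ _] := HS i.
have pT : p \co (incl T \co r) = incl (S i) \co s i \co p.
  apply: (coproduct_eq dec_M) => k; rewrite -compA Ts compA -compA.
  have [->|ne_ki] := classic (k = i).
    by rewrite compA pi comp1m -[in RHS]compA pi compm1.
  by rewrite -[in RHS]compA pk // compA pk // comp0m compm0.
have pf j : p \co f j = g i j \co p.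
  apply: (coproduct_eq dec_M) => k; rewrite -!compA Eg compA.
  have [->|ne_ki] := classic (k = i); first by rewrite pi comp1m compm1.
  by rewrite pk // comp0m compm0.
(* [p \co incl U] need not be monic, hence the detour through its image. *)
have [V ImV] := Im_exists (p \co incl U).
have [e Ee] := proj1 (Im_leP _ ImV) (subob_le_refl V).
have epi_e := Im_corestriction_epi ImV Ee.
have [b Eb] : subob_le V (S i).
  apply/leS => j; apply: epi_e.
  by rewrite -compA -Ee compA -pf -compA fU0 compm0 comp0m.
by rewrite compA pT -compA Ee Eb -!compA (compA (s i)) sS comp1m.
Qed.

Lemma dual_Baer_direct_sum :
  (forall i, fully_invariant (M_ i)) ->
  (forall i, dual_strongly_self_Baer (M_ i : A)) -> dual_strongly_self_Baer M.
Proof.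
move=> fiM Baer; apply/dual_strongly_self_BaerP => J f.
have [g Eg] := choose_family (fun i => choose_family (fun j => fiM i (f j))).
have [S HS] := choose_family
  (fun i => proj1 (dual_strongly_self_BaerP (M_ i)) (Baer i) J (g i)).
have [T [r [s [rT fiT sS Ts]]]] := @gather_summands S fiM
  (fun i => let: And3 _ ds _ := HS i in ds)
  (fun i => let: And3 _ _ fi := HS i in fi).
exists T; split=> //; last by apply/direct_summandP; exists r.
move=> U; split=> [TU j|fU].
  apply: factors_le TU; exists (r \co f j); rewrite compA.
  apply: (coproduct_eq dec_M) => i.
  rewrite -compA Eg compA Ts -!compA; have [leS _ _] := HS i.
  have [a ->] := proj1 (leS _) (subob_le_refl _) j.
  by rewrite (compA (s i)) sS comp1m.
(* With [U] the kernel of [q], it remains that [q] kills the idempotent of [T], a morphism out of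
   [M] that can be tested on components. *)
have [Z [q kerU]] := subobject_is_Ker U; apply/(le_KerP _ kerU).
rewrite -[incl T]compm1 -rT !compA -(compA q).
suff -> : q \co (incl T \co r) = 0 by rewrite comp0m.
apply: (coproduct_eq dec_M) => i; rewrite comp0m -compA Ts !compA.
(* [K] is the preimage of [U] in [M_ i]; it contains the images of all [g i j], hence their sum
   [S i]. *)
have [K kerK] := Ker_exists (q \co incl (M_ i)); have [leS _ _] := HS i.
have /(le_KerP _ kerK) -> : subob_le (S i) K; last by rewrite comp0m.
apply/leS => j; apply: kernel_factor kerK _.
by rewrite -compA -Eg; have [y ->] := fU j; rewrite !compA (proj1 kerU) !comp0m.
Qed.

End DirectSum.

End Abelian.

Theorem theorem6p5 (A : abelianCat) (M : A) (I : Type)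
    (M_ : I -> subobject M) (hM : is_direct_sum_decomposition M_) :
  ((strongly_self_Baer M ->
      [/\ forall i : I, strongly_self_Baer (M_ i : A),
          pairwise_hom_zero M_ & summands_decompose M_]) /\
   (projections_jointly_monic M_ ->
      [/\ forall i : I, strongly_self_Baer (M_ i : A),
          pairwise_hom_zero M_ & summands_decompose M_] ->
      strongly_self_Baer M))
  /\
  (dual_strongly_self_Baer M <->
      [/\ forall i : I, dual_strongly_self_Baer (M_ i : A),
          pairwise_hom_zero M_ & summands_decompose M_]).
Proof.
have dsM i := component_direct_summand hM i.
split; [split=> [Baer|joint [Baer hom0 decomp]] | split=> [Baer|[Baer hom0 decomp]]].
- have fiM i := Baer_summand_invariant Baer (dsM i).
  split=> [i||]; first exact: Baer_summand.
    exact: invariant_hom_zero.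
  exact: invariant_summands_decompose.
- exact: Baer_direct_sum (orthogonal_components_invariant hM hom0 decomp) joint Baer.
- have fiM i := dual_Baer_summand_invariant Baer (dsM i).
  split=> [i||]; first exact: dual_Baer_summand.
    exact: invariant_hom_zero.
  exact: invariant_summands_decompose.
- exact: dual_Baer_direct_sum (orthogonal_components_invariant hM hom0 decomp) Baer.
Qed.
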